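(* Let $a,b,g,h$ be real functions that are Lebesgue measurable and locally essentially bounded, with $a(t)\ge 0$, $b(t)\ge 0$, $g(t)\le t$, $h(t)\ge t$ and $\lim_{t\to\infty} g(t)=\infty$. Suppose that for $t$ sufficiently large $a(t)\ge b(t)$ and $$b(t)\ge a(t)\left[\exp\left\{\int_{g(t)}^t a(s)\,ds\right\}-1\right]\exp\left\{\int_t^{h(t)}a(s)\,ds\right\}.$$ Then there exists an eventually positive solution with an eventually nonpositive derivative of the equation $$\dot{x}(t)+a(t)x(g(t))-b(t)x(h(t))=0,\quad t\ge t_0.$$
   Context: The functions $a,b,g,h$ are considered for $t\ge t_0$. A solution of the differential equation is a function $x:\mathbb{R}\to\mathbb{R}$, absolutely continuous on each interval $[t_0,c]$, which satisfies the equation for almost all $t\in[t_0,\infty)$ and satisfies $x(t)=\varphi(t)$ for $t<t_0$, $x(t_0)=x_0$, for some initial function $\varphi$ and initial value $x_0$. ''Eventually'' means for all sufficiently large $t$; sign conditions on derivatives are understood almost everywhere.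
   Formalization: The solution is asserted on [t_1,∞) for some t_1 ≥ t_0 (initial function and value given at t_1), not on [t_0,∞): with t_1 = t_0 the claim fails, e.g. t_0=0, a=1, b=0, h(t)=t, g=0 on [0,1], g(t)=t for t>1. *)

(* Defs.v *)
From HB Require Import structures.
From mathcomp Require Import all_boot all_order all_algebra.
From mathcomp Require Import all_classical all_reals all_analysis.

Set Implicit Arguments.
Unset Strict Implicit.
Unset Printing Implicit Defensive.

Import Order.TTheory GRing.Theory Num.Theory.
Import numFieldNormedType.Exports.

Local Open Scope classical_set_scope.
Local Open Scope ring_scope.

(* [lebesgue_measure] lives on the Borel sigma-algebra.  Everything below uses
   its completion instead, so that "measurable" means Lebesgue measurable (and
   not just Borel measurable) for the functions a, b, g, h. *)
Notation leb := completed_lebesgue_measure.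

(* The real line with the sigma-algebra of Lebesgue measurable sets, i.e. the
   measurable space on which [leb] is defined. *)
Notation lebesgueTypeR R := (caratheodory_type (@wlength R idfun)^*%mu).

(* The codomain carries the Borel sigma-algebra. *)
Definition lebesgue_measurable_fun (R : realType) (D : set R) (f : R -> R) :=
  measurable_fun (D : set (lebesgueTypeR R)) (f : _ -> measurableTypeR R).

Definition locally_essentially_bounded (R : realType) (t0 : R) (f : R -> R) :=
  forall c : R, exists M : R,
    {ae @leb R, forall t : R, t0 <= t <= c -> `|f t| <= M}.

Definition absolutely_continuous_on (R : realType) (c d : R) (x : R -> R) :=
  forall e : R, 0 < e -> exists2 delta : R, 0 < delta &
    forall (n : nat) (u v : 'I_n -> R),
      (forall i, c <= u i /\ u i <= v i /\ v i <= d) ->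
      trivIset [set: 'I_n] (fun i => `]u i, v i[%classic) ->
      \sum_(i < n) (v i - u i) < delta ->
      \sum_(i < n) `|x (v i) - x (u i)| < e.

(* x solves  x'(t) + a(t) x(g(t)) - b(t) x(h(t)) = 0  for t >= t1, with initial
   function phi on ]-oo, t1[ and initial value x1 at t1. *)
Definition is_solution (R : realType) (a b g h : R -> R)
    (t1 : R) (phi : R -> R) (x1 : R) (x : R -> R) :=
  [/\ forall c, t1 <= c -> absolutely_continuous_on t1 c x,
      {ae @leb R, forall t : R, t1 <= t ->
         derivable x t 1 /\ derive1 x t + a t * x (g t) - b t * x (h t) = 0},
      forall t, t < t1 -> x t = phi t
    & x t1 = x1].

(* Main.v *)
Require Import Defs.
From HB Require Import structures.
From mathcomp Require Import all_boot all_order all_algebra.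
From mathcomp Require Import all_classical all_reals all_analysis.
From mathcomp Require Import measurable_realfun.
From mathcomp Require Import lra.

(** Look for a solution in the form x = exp (- U), where U is the primitive of
    a nonnegative locally integrable function u that vanishes far to the left.
    Then x is positive, x' = - u x almost everywhere, and the differential
    equation for t >= t1 becomes the fixpoint equation u = S u, with
<<
      S u t = a t * exp (U t - U (g t)) - b t * exp (U t - U (h t)).
>>
    Since g t <= t <= h t, the first exponent is the integral of u over
    ]g t, t] and the second one is minus the integral of u over ]t, h t]; as
    a and b are nonnegative, S is monotone ([step_le]).  Moreover:
    - 0 is a subsolution, because S 0 = a - b >= 0 ([step0_ge0]);
    - a is a supersolution, because S a <= a is, after division by the second
      exponential, the lower bound assumed on b ([step_restrict_le]).
    So the iterates of S from 0 increase and stay below a.  Their pointwise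
    limit u is a fixpoint, since dominated convergence lets S pass to the limit
    ([step_fixpoint]).

    What remains is to read off the solution.  On a bounded interval u is
    essentially bounded, as a is, so U and exp (- U) are Lipschitz there, hence
    absolutely continuous ([exp_sol_ac]).  The derivative of U is u almost
    everywhere by the Lebesgue differentiation theorem ([completed_FTC1Ny]).
    That theorem is about Borel functions, whereas u is only Lebesgue
    measurable: it is applied to a Borel function equal to u almost everywhere
    ([borel_version]), which changes neither U nor the conclusion. *)

Import Order.TTheory GRing.Theory Num.Theory.
Import numFieldNormedType.Exports.

Local Open Scope classical_set_scope.
Local Open Scope ring_scope.

Set Implicit Arguments.
Unset Strict Implicit.
Unset Printing Implicit Defensive.

(** * Lebesgue measure on the Borel sets and its completion *)

Section completion.
Context {R : realType}.
Notation T := (lebesgueTypeR R).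
Notation B := (measurableTypeR R).
Notation mu := (@lebesgue_measure R).

Lemma borel_lebesgue (A : set R) :
  measurable (A : set B) -> measurable (A : set T).
Proof. exact: sub_caratheodory. Qed.

Lemma measurable_id_completion : measurable_fun [set: T] (id : T -> B).
Proof. by move=> _ Y mY; rewrite setTI preimage_id; exact: borel_lebesgue. Qed.

Lemma negligible_completion (N : set R) :
  mu.-negligible (N : set B) -> leb.-negligible (N : set T).
Proof.
by move=> [A [mA A0 NA]]; exists A; split => //; exact: borel_lebesgue.
Qed.

Lemma lebesgue_measurable_borel_core (E : set R) : measurable (E : set T) ->
  exists2 A : set B, measurable A & A `<=` E /\ leb.-negligible (E `\` A).
Proof.
rewrite -completed_caratheodory_measurable g_sigma_completed_algebra_genE.
move=> [A mA [N nN <-]]; exists A => //; split; first by move=> x; left.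
apply: negligible_completion; apply: negligibleS nN.
by move=> x [[]].
Qed.

(** The two measures are given by the same outer measure, so the Borel one is
    the image of the completed one under the identity map. *)
Lemma ge0_integral_completion (D : set R) (f : R -> \bar R) :
  measurable (D : set B) -> measurable_fun (D : set B) f ->
  (forall x, D x -> 0 <= f x)%E ->
  (\int[leb]_(x in (D : set T)) f x = \int[mu]_(x in (D : set B)) f x)%E.
Proof.
move=> mD mf f0.
transitivity (\int[pushforward leb (id : T -> B)]_(x in (D : set B)) f x)%E.
  rewrite (ge0_integral_pushforward measurable_id_completion)//.
  by move=> y /set_mem; exact: f0.
by [].
Qed.

Lemma integral_completion (D : set R) (f : R -> \bar R) :
  measurable (D : set B) -> measurable_fun (D : set B) f ->
  (\int[leb]_(x in (D : set T)) f x = \int[mu]_(x in (D : set B)) f x)%E.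
Proof.
move=> mD mf; rewrite integralE [RHS]integralE.
rewrite !ge0_integral_completion//; first exact: measurable_funeneg.
exact: measurable_funepos.
Qed.

(** Each superlevel set f > q with q rational has a Borel subset A q of full
    measure in it.  Outside the countable union of the null differences,
    f x is the supremum of the q such that x is in A q, and that supremum is
    Borel measurable in x because its superlevel sets are countable unions of
    sets A q.  The supremum is taken in the extended reals, as it may be
    infinite on the null set. *)
Lemma borel_version (f : R -> R) :
  measurable_fun [set: T] (f : T -> B) ->
  exists2 v : B -> R, measurable_fun [set: B] v &
    {ae @leb R, forall x, f x = v x}.
Proof.
move=> mf.
have lvl (q : rat) : {A : set B | measurable A /\
    (A `<=` [set x | ratr q < f x] /\
     leb.-negligible ([set x : T | ratr q < f x] `\` A))}.
  apply: cid.
  have : measurable ([set x | ratr q < f x] : set T).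
    have := mf measurableT `]ratr q, +oo[%classic (measurable_itv _).
    by rewrite setTI preimage_itvoy.
  by move=> /lebesgue_measurable_borel_core[A mA [AE nEA]]; exists A.
pose A q := projT1 (lvl q).
have mA q : measurable (A q) by have [] := projT2 (lvl q).
have Af q x : A q x -> ratr q < f x by have [_ [+ _]] := projT2 (lvl q); exact.
pose N := \bigcup_(n : nat)
  oapp (fun q : rat => [set x : T | ratr q < f x] `\` A q) set0 (unpickle n).
pose w (x : B) : \bar R := ereal_sup [set (ratr q : R)%:E | q in [set q | A q x]].
have mw : measurable_fun [set: B] w.
  apply: (measurability _ (ErealGenOInfty.measurableE R)) => //.
  move=> /= _ [_ [a ->] <-]; rewrite setTI.
  rewrite [X in measurable X](_ : _ =
    \bigcup_(q : rat) (if a < ratr q then A q else set0)); last first.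
    apply/seteqP; split => x /=.
      rewrite in_itv/= andbT => /ereal_sup_gt[_ [q Aq <-]].
      by rewrite lte_fin => aq; exists q => //; rewrite aq.
    move=> [q _]; case: ifPn => // aq Aq; rewrite in_itv/= andbT.
    rewrite (@lt_le_trans _ _ (ratr q)%:E)%E ?lte_fin//.
    by apply: ereal_sup_ubound; exists q.
  by apply: bigcupT_measurable_rat => q; case: ifPn.
exists (fine \o w); first by apply: measurableT_comp => //; exact: fine_measurable.
have [N' [mN' N'0 NN']] : leb.-negligible N.
  apply: negligible_bigcup => n; case: (unpickle n) => [q|] /=.
    by have [_ []] := projT2 (lvl q).
  exact: negligible_set0.
exists N'; split => //; apply: subset_trans NN' => x /=.
apply: contra_notP => Nx /=; suff -> : w x = (f x)%:E by [].
apply/eqP; rewrite eq_le; apply/andP; split.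
  by apply: ge_ereal_sup => _ [q Aq <-]; rewrite lee_fin ltW// Af.
apply/lee_subgt0Pr => e e0; rewrite -EFinB.
have [q] : exists q, ratr q \in `]f x - e, f x[ by apply: rat_in_itvoo; rewrite ltrBlDr ltrDl.
rewrite in_itv/= => /andP[q1 q2].
have Aq : A q x by apply: contrapT => nA; apply: Nx; exists (pickle q); rewrite ?pickleK.
by apply: (@le_trans _ _ (ratr q)%:E); [rewrite lee_fin ltW|apply: ereal_sup_ubound; exists q].
Qed.

End completion.

(** * Primitives of Lebesgue measurable functions *)

Section primitive.
Context {R : realType}.
Notation T := (lebesgueTypeR R).
Notation B := (measurableTypeR R).
Notation mu := (@lebesgue_measure R).

#[global] Instance ae_completed_filter :
  Filter (nbhs (almost_everywhere (@leb R))) := ae_filter_ringOfSetsType _.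

(** The differentiation theorem for the Borel sigma-algebra, transferred to a
    Lebesgue measurable f through a Borel function that equals f almost
    everywhere and has the same primitive. *)
Lemma completed_FTC1Ny (f : R -> R) :
  measurable_fun [set: T] (f : T -> B) ->
  (forall y, leb.-integrable (`]-oo, y]%classic : set T) (EFin \o f)) ->
  let F x := \int[leb]_(t in (`]-oo, x]%classic : set T)) f t in
  {ae @leb R, forall x, derivable (F : R -> R) x 1 /\ derive1 (F : R -> R) x = f x}.
Proof.
move=> mf intf F.
have [v mv fv] := borel_version mf.
have mvT : measurable_fun [set: T] (v : T -> B).
  exact: (measurableT_comp mv measurable_id_completion).
have mitv y : measurable (`]-oo, y]%classic : set T) by exact: borel_lebesgue.
have intv y : mu.-integrable (`]-oo, y]%classic : set B) (EFin \o v).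
  apply/integrableP; split.
    by apply/measurable_EFinP; exact: measurable_funTS.
  rewrite -ge0_integral_completion//; last first.
    do 2 apply: measurableT_comp => //; exact: measurable_funTS.
  have /integrableP[_] := intf y; apply: le_lt_trans.
  apply: ae_ge0_le_integral.
  - exact: mitv.
  - by move=> x _; exact: abse_ge0.
  - by do 2 apply: measurableT_comp => //; exact: measurable_funTS.
  - by move=> x _; exact: abse_ge0.
  - by do 2 apply: measurableT_comp => //; exact: measurable_funTS.
  - by apply: filterS fv => x /= ->.
have Fv : F = fun x => \int[mu]_(t in (`]-oo, x]%classic : set B)) v t.
  apply/funext => x; rewrite /F /Rintegral -integral_completion//; last first.
    by apply/measurable_EFinP; exact: measurable_funTS.
  congr fine; apply: ae_eq_integral.
  - exact: mitv.
  - by apply/measurable_EFinP; exact: measurable_funTS.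
  - by apply/measurable_EFinP; exact: measurable_funTS.
  - by apply: filterS fv => y /= ->.
have locv : locally_integrable [set: R] v.
  split => //; first exact: openT.
  move=> K _ cK; have [M [_ /(_ (M + 1))]] := compact_bounded cK.
  rewrite ltrDl ltr01 => /(_ isT) KM.
  have /integrableP[_] := intv (M + 1); apply: le_lt_trans.
  apply: ge0_subset_integral => //=; first exact: compact_measurable.
    do 2 apply: measurableT_comp => //; exact: measurable_funTS.
  by move=> x Kx /=; rewrite in_itv/= (le_trans (ler_norm _))// KM.
have [N [mN N0 NF]] := FTC1Ny intv locv.
have aeF : {ae @leb R, forall x, derivable (F : R -> R) x 1 /\
    derive1 (F : R -> R) x = v x}.
  by rewrite Fv; apply: negligible_completion; exists N.
by apply: filterS2 fv aeF => x -> .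
Qed.

(** Integrating from minus infinity makes this a primitive of u on the whole
    line, so that no case distinction is needed when g t lies to the left of the
    point where the equation starts. *)
Definition cumint (u : R -> R) (s : R) : R :=
  \int[leb]_(r in (`]-oo, s]%classic : set T)) u r.

(** The functions whose primitive [cumint] is well behaved: Lebesgue measurable
    and integrable on every left half-line. *)
Definition left_integrable (u : R -> R) :=
  measurable_fun [set: T] (u : T -> B) /\
  forall s, leb.-integrable (`]-oo, s]%classic : set T) (EFin \o u).

Lemma left_integrable_le (u v : R -> R) :
  measurable_fun [set: T] (u : T -> B) -> (forall t, 0 <= u t <= v t) ->
  left_integrable v -> left_integrable u.
Proof.
move=> mu_ uv [_ iv]; split => // s.
apply: le_integrable (iv s) => //.
- exact: borel_lebesgue.
- by apply/measurable_EFinP; exact: measurable_funTS.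
- move=> x _ /=; have /andP[u0 uvx] := uv x.
  by rewrite lee_fin !ger0_norm// (le_trans u0).
Qed.

Lemma left_integrable_itv (u : R -> R) (i : interval R) (s : R) :
  left_integrable u -> [set` i] `<=` `]-oo, s]%classic ->
  leb.-integrable ([set` i] : set T) (EFin \o u).
Proof.
by move=> [_ iu] is_; apply: integrableS (iu s) => //; exact: borel_lebesgue.
Qed.

Lemma cumintB (u : R -> R) (s t : R) : left_integrable u -> s <= t ->
  cumint u t - cumint u s = \int[leb]_(r in (`]s, t]%classic : set T)) u r.
Proof.
move=> iu st; rewrite /cumint (@itv_bndbnd_setU _ _ -oo%O (BRight s) (BRight t))//.
rewrite Rintegral_setU//; first by rewrite addrC addKr.
- exact: borel_lebesgue.
- exact: borel_lebesgue.
- by rewrite -itv_bndbnd_setU//; exact: iu.2.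
- apply/disj_setPS => y [/=]; rewrite 2!in_itv/= => ys /andP[].
  by rewrite ltNge ys.
Qed.

Lemma cumintB_le (u v : R -> R) (s t : R) : left_integrable u ->
  left_integrable v -> (forall r, u r <= v r) -> s <= t ->
  cumint u t - cumint u s <= cumint v t - cumint v s.
Proof.
move=> iu iv uv st; rewrite !cumintB//.
have sub : [set` `]s, t]] `<=` `]-oo, t]%classic.
  by move=> x /=; rewrite !in_itv/= => /andP[].
apply: le_Rintegral => //.
- exact: borel_lebesgue.
- exact: left_integrable_itv sub.
- exact: left_integrable_itv sub.
Qed.

Lemma cumint_nondecreasing (u : R -> R) : left_integrable u ->
  (forall r, 0 <= u r) -> nondecreasing_fun (cumint u).
Proof.
move=> iu u0 s t st; rewrite -subr_ge0 cumintB//.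
exact: Rintegral_ge0.
Qed.

Lemma cumint_ge0 (u : R -> R) (s : R) : (forall r, 0 <= u r) -> 0 <= cumint u s.
Proof. by move=> u0; exact: Rintegral_ge0. Qed.

Lemma cumint0 (s : R) : cumint (fun=> 0 : R) s = 0.
Proof. by rewrite /cumint Rintegral_cst ?mul0r//; exact: borel_lebesgue. Qed.

Lemma cumint_cvg (u : nat -> R -> R) (v w : R -> R) (s : R) :
  (forall n, left_integrable (u n)) -> left_integrable v -> left_integrable w ->
  (forall n r, `|u n r| <= w r) -> (forall r, u n r @[n --> \oo] --> v r) ->
  cumint (u n) s @[n --> \oo] --> cumint v s.
Proof.
move=> iu iv iw uw uv; apply: fine_cvg.
rewrite fineK; last by apply: integrable_fin_num (iv.2 s) => //; exact: borel_lebesgue.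
apply: (@dominated_cvg _ _ _ leb _ _ (fun n r => (u n r)%:E)
  (fun r => (v r)%:E) (fun r => (w r)%:E)).
- exact: borel_lebesgue.
- by move=> n; apply/measurable_EFinP/measurable_funTS; exact: (iu n).1.
- by move=> r _; apply: cvg_EFin; [exact: nearW|exact: uv].
- by [].
- exact: iw.2.
- by move=> n r _; rewrite /= lee_fin.
Qed.

Lemma cumint_lipschitz (u : R -> R) (c d M : R) : left_integrable u ->
  (forall r, 0 <= u r) -> 0 <= M ->
  {ae @leb R, forall r, c <= r <= d -> u r <= M} ->
  forall s t, c <= s -> s <= t -> t <= d ->
  cumint u t - cumint u s <= M * (t - s).
Proof.
move=> iu u0 M0 uM s t cs st td; rewrite cumintB//.
have mst : measurable (`]s, t]%classic : set T) by exact: borel_lebesgue.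
have sub : [set` `]s, t]] `<=` `]-oo, t]%classic.
  by move=> x /=; rewrite !in_itv/= => /andP[].
rewrite -lee_fin fineK; last first.
  by apply: integrable_fin_num => //; exact: left_integrable_itv sub.
apply: (@le_trans _ _ (\int[leb]_(x in (`]s, t]%classic : set T)) M%:E)%E).
  apply: ae_ge0_le_integral.
  - exact: mst.
  - by move=> x _; rewrite lee_fin.
  - by apply/measurable_EFinP/measurable_funTS; exact: iu.1.
  - by move=> x _; rewrite lee_fin.
  - exact: measurable_cst.
  - apply: filterS uM => x /= uMx; rewrite in_itv/= => /andP[sx xt].
    by rewrite lee_fin uMx// (le_trans cs (ltW sx)) (le_trans xt).
rewrite integral_cst//= [X in (_ * X)%E](_ : _ = (t - s)%:E)//.
rewrite -[LHS]/(mu `]s, t]) lebesgue_measure_itv/= lte_fin.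
by case: ltgtP st => // ->; rewrite subrr.
Qed.

(** Extending a by 0 to the left of t0 leaves only the essentially bounded part
    of a on a segment in the integral over a left half-line. *)
Lemma left_integrable_restrict (a : R -> R) (t0 : R) :
  lebesgue_measurable_fun `[t0, +oo[ a -> locally_essentially_bounded t0 a ->
  left_integrable (a \_ `[t0, +oo[).
Proof.
move=> ma bda.
have mA : measurable_fun [set: T] (a \_ `[t0, +oo[ : T -> B).
  have m0 : measurable (`[t0, +oo[%classic : set T) by exact: borel_lebesgue.
  exact: (measurable_restrictT (a : T -> B) m0).1.
split=> // s; have [M aM] := bda s.
have ms : measurable (`]-oo, s]%classic : set T) by exact: borel_lebesgue.
have m0s : measurable (`[t0, s]%classic : set T) by exact: borel_lebesgue.
apply/integrableP; split.
  by apply/measurable_EFinP; exact: measurable_funTS.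
apply: (@le_lt_trans _ _ (\int[leb]_(x in (`]-oo, s]%classic : set T))
    (`|M|%:E * (\1_(`[t0, s]%classic : set T) x)%:E))%E).
  apply: ae_ge0_le_integral.
  - exact: ms.
  - by move=> x _; exact: abse_ge0.
  - by do 2 apply: measurableT_comp => //; exact: measurable_funTS.
  - by move=> x _; rewrite mule_ge0.
  - apply: emeasurable_funM; first exact: measurable_cst.
    by apply/measurable_EFinP/measurable_funTS; exact: measurable_indic.
  - apply: filterS aM => x /= aMx; rewrite in_itv/= => xs.
    rewrite lee_fin patchE indicE !mem_setE !in_itv/= xs !andbT.
    case: ifPn => t0x; last by rewrite normr0 mulr_ge0.
    by rewrite mulr1 (le_trans (aMx _))// ?ler_norm// t0x.
rewrite ge0_integralZl_EFin; first last.
- exact: normr_ge0.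
- by apply/measurable_EFinP/measurable_funTS; exact: measurable_indic.
- by move=> x _; rewrite lee_fin.
- exact: ms.
rewrite integral_indic//= lte_mul_pinfty//.
apply: (@le_lt_trans _ _ (leb (`[t0, s]%classic : set T))).
  by apply: le_measure; rewrite ?inE//; exact: measurableI.
rewrite -[X in (X < _)%E]/(mu `[t0, s]) lebesgue_measure_itv/= lte_fin.
by case: ifP => _; rewrite ltry.
Qed.

End primitive.

(** * The monotone fixpoint problem *)

Section iteration.
Context {R : realType}.
Notation T := (lebesgueTypeR R).
Notation B := (measurableTypeR R).
Variables (t1 : R) (a b g h A : R -> R).

(** For x = exp (- cumint u) and t >= t1, the differential equation says exactly
    that u t = step u t; see [exp_sol_equation].  The value 0 to the left of t1
    makes x constant there. *)
Definition step (u : R -> R) (t : R) : R :=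
  if t1 <= t then
    a t * expR (cumint u t - cumint u (g t))
    - b t * expR (cumint u t - cumint u (h t))
  else 0.

Hypothesis a_ge0 : forall t, t1 <= t -> 0 <= a t.
Hypothesis b_ge0 : forall t, t1 <= t -> 0 <= b t.
Hypothesis g_le : forall t, t1 <= t -> g t <= t.
Hypothesis h_ge : forall t, t1 <= t -> t <= h t.

(** Enlarging u enlarges its integral over ]g t, t], hence the first term, and
    its integral over ]t, h t], which decreases the subtracted second term. *)
Lemma step_le (u v : R -> R) : left_integrable u -> left_integrable v ->
  (forall t, u t <= v t) -> forall t, step u t <= step v t.
Proof.
move=> iu iv uv t; rewrite /step; case: (boolP (t1 <= t)) => [t1t|_]; last exact: lexx.
apply: lerB; apply: ler_wpM2l.
- exact: a_ge0.
- by rewrite ler_expR; apply: cumintB_le (g_le t1t).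
- exact: b_ge0.
- by rewrite ler_expR -lerN2 !opprB; apply: cumintB_le (h_ge t1t).
Qed.

Hypothesis a_meas : measurable_fun (`[t1, +oo[%classic : set T) (a : T -> B).
Hypothesis b_meas : measurable_fun (`[t1, +oo[%classic : set T) (b : T -> B).
Hypothesis g_meas : measurable_fun (`[t1, +oo[%classic : set T) (g : T -> B).
Hypothesis h_meas : measurable_fun (`[t1, +oo[%classic : set T) (h : T -> B).

(** Measurability of g suffices for the composition with [cumint u], which is
    Borel measurable as a nondecreasing function. *)
Lemma step_measurable (u : R -> R) : left_integrable u ->
  (forall t, 0 <= u t) -> measurable_fun [set: T] (step u : T -> B).
Proof.
move=> iu u0.
have m1 : measurable (`[t1, +oo[%classic : set T) by exact: borel_lebesgue.
have mcum : measurable_fun [set: B] (cumint u : B -> B).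
  by apply: nondecreasing_measurable => //; exact: cumint_nondecreasing.
have mexp k : measurable_fun (`[t1, +oo[%classic : set T) (k : T -> B) ->
    measurable_fun (`[t1, +oo[%classic : set T)
      (fun t : T => expR (cumint u t - cumint u (k t)) : B).
  move=> mk; apply: (@measurableT_comp _ _ _ T B B expR); first exact: measurable_expR.
  apply: measurable_funB; last exact: (measurableT_comp mcum mk).
  apply: measurable_funTS.
  exact: (measurableT_comp mcum measurable_id_completion).
rewrite (_ : step u = (fun t => a t * expR (cumint u t - cumint u (g t))
    - b t * expR (cumint u t - cumint u (h t))) \_ `[t1, +oo[); last first.
  by apply/funext => t; rewrite patchE mem_setE in_itv/= andbT.
apply/(measurable_restrictT _ m1).1.
by apply: measurable_funB; (apply: measurable_funM; last exact: mexp).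
Qed.

Hypothesis A_int : left_integrable A.
Hypothesis A_ge0 : forall t, 0 <= A t.
Hypothesis ab : forall t, t1 <= t -> b t <= a t.
Hypothesis A_super : forall t, step A t <= A t.

Lemma left_integrable0 : left_integrable (fun _ : R => 0 : R).
Proof.
by apply: left_integrable_le A_int => // t; rewrite lexx A_ge0.
Qed.

Lemma step0_ge0 (t : R) : 0 <= step (fun=> 0) t.
Proof.
rewrite /step; case: (boolP (t1 <= t)) => [t1t|_]; last exact: lexx.
by rewrite !cumint0 subrr expR0 !mulr1 subr_ge0 ab.
Qed.

Definition iterate (n : nat) : R -> R := iter n step (fun=> 0).

Lemma iterate_bounds n : left_integrable (iterate n) /\
  forall t, 0 <= iterate n t <= A t.
Proof.
elim: n => [|n [iun bun]] /=.
  by split; [exact: left_integrable0 | move=> t; rewrite lexx A_ge0].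
have bS t : 0 <= step (iterate n) t <= A t.
  apply/andP; split.
    apply: le_trans (step0_ge0 t) _.
    apply: step_le; [exact: left_integrable0|exact: iun|].
    by move=> r; have /andP[] := bun r.
  apply: le_trans (A_super t).
  by apply: step_le => // r; have /andP[] := bun r.
split; last exact: bS.
apply: left_integrable_le bS A_int.
by apply: step_measurable => // t; have /andP[] := bun t.
Qed.

Lemma iterate_nondecreasing t : nondecreasing_seq (iterate ^~ t).
Proof.
apply/nondecreasing_seqP => n; elim: n t => [|n IHn] t.
  exact: step0_ge0.
apply: step_le IHn _; first exact: (iterate_bounds n).1.
exact: (iterate_bounds n.+1).1.
Qed.

(** The limit of the increasing sequence of iterates; the supersolution A bounds
    it and serves as the dominating function when the primitives pass to the
    limit. *)
Lemma step_fixpoint : exists u : R -> R,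
  [/\ left_integrable u, forall t, 0 <= u t <= A t & forall t, u t = step u t].
Proof.
have cvgi t : cvgn (iterate ^~ t).
  apply: nondecreasing_is_cvgn; first exact: iterate_nondecreasing.
  by exists (A t) => _ [n _ <-]; have [_ /(_ t)/andP[]] := iterate_bounds n.
pose u t := limn (iterate ^~ t).
have uE t : iterate n t @[n --> \oo] --> u t by exact: cvgi.
have bu t : 0 <= u t <= A t.
  apply/andP; split.
    apply: limr_ge => //; apply: nearW => n.
    by have [_ /(_ t)/andP[]] := iterate_bounds n.
  apply: limr_le => //; apply: nearW => n.
  by have [_ /(_ t)/andP[]] := iterate_bounds n.
have iu : left_integrable u.
  apply: left_integrable_le bu A_int.
  apply: (@measurable_fun_cvg _ T R _ iterate) => [n|t _]; last exact: uE.
  exact: (iterate_bounds n).1.1.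
have cumu s : cumint (iterate n) s @[n --> \oo] --> cumint u s.
  apply: (cumint_cvg (w := A)) => // [n|n r]; first exact: (iterate_bounds n).1.
  by have [_ /(_ r)/andP[i0 iA]] := iterate_bounds n; rewrite ger0_norm.
exists u; split=> // t.
have stepu : step (iterate n) t @[n --> \oo] --> step u t.
  rewrite /step; case: (t1 <= t); last exact: cvg_cst.
  have cexp s : expR (cumint (iterate n) t - cumint (iterate n) s)
      @[n --> \oo] --> expR (cumint u t - cumint u s).
    apply: continuous_cvg; first exact: continuous_expR.
    exact: cvgB.
  by apply: cvgB; apply: cvgM => //; exact: cvg_cst.
have uS : step (iterate n) t @[n --> \oo] --> u t.
  by have := uE t; rewrite -cvg_shiftS.
by rewrite -(cvg_lim (@Rhausdorff R) stepu) -[LHS](cvg_lim (@Rhausdorff R) uS).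
Qed.

End iteration.

(** * From the fixpoint to the solution *)

Section exponential_of_primitive.
Context {R : realType}.
Notation T := (lebesgueTypeR R).
Notation B := (measurableTypeR R).

Lemma lipschitz_absolutely_continuous (x : R -> R) (c d M : R) : 0 <= M ->
  (forall s t, c <= s -> s <= t -> t <= d -> `|x t - x s| <= M * (t - s)) ->
  absolutely_continuous_on c d x.
Proof.
move=> M0 xM e e0; have M1 : 0 < M + 1 by rewrite ltr_wpDl.
exists (e / (M + 1)); first exact: divr_gt0.
move=> n p q pq _; rewrite ltr_pdivlMr// mulrC => sume.
apply: le_lt_trans sume; rewrite mulr_sumr.
apply: ler_sum => i _; have [cp [le_pq qd]] := pq i.
apply: (le_trans (xM _ _ cp le_pq qd)).
by apply: ler_wpM2r; rewrite ?subr_ge0// lerDl.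
Qed.

Lemma expRN_lipschitz (p q : R) : 0 <= p -> p <= q ->
  `|expR (- q) - expR (- p)| <= q - p.
Proof.
move=> p0 pq; have qp : expR (- q) <= expR (- p) by rewrite ler_expR lerN2.
rewrite distrC ger0_norm ?subr_ge0//.
have -> : expR (- q) = expR (- p) * expR (p - q).
  by rewrite -expRD addrA addNr add0r.
rewrite -[X in X - _]mulr1 -mulrBr.
have e1 : 1 - expR (p - q) <= q - p.
  by rewrite lerBlDr -lerBlDl opprB (le_trans _ (expR_ge1Dx _))// addrC.
apply: (le_trans _ e1); apply: ler_piMl.
  by rewrite subr_ge0 -expR0 ler_expR subr_le0.
by rewrite -expR0 ler_expR oppr_le0.
Qed.

Definition exp_sol (u : R -> R) (t : R) : R := expR (- cumint u t).

Lemma exp_sol_ac (u : R -> R) (c d M : R) : left_integrable u ->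
  (forall t, 0 <= u t) ->
  {ae @leb R, forall t : R, c <= t <= d -> u t <= M} ->
  absolutely_continuous_on c d (exp_sol u).
Proof.
move=> iu u0 uM.
have {}uM : {ae @leb R, forall t : R, c <= t <= d -> u t <= `|M|}.
  apply: filterS uM => t /= + ctd => /(_ ctd) /le_trans; apply.
  exact: ler_norm.
apply: (@lipschitz_absolutely_continuous _ _ _ `|M|) => // s t cs st td.
apply: le_trans (cumint_lipschitz iu u0 (normr_ge0 M) uM cs st td).
apply: expRN_lipschitz; first exact: cumint_ge0.
exact: cumint_nondecreasing.
Qed.

Lemma exp_sol_derive (u : R -> R) : left_integrable u ->
  {ae @leb R, forall t, derivable (exp_sol u : R -> R) t 1 /\
    derive1 (exp_sol u : R -> R) t = - (u t * exp_sol u t)}.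
Proof.
move=> iu; have := completed_FTC1Ny iu.1 iu.2.
apply: filterS => t [dF F'].
have isF : is_derive t 1 (cumint u : R -> R) (u t).
  by apply: DeriveDef; [exact: dF|rewrite -derive1E; exact: F'].
have isx : is_derive t 1 (exp_sol u : R -> R) (expR (- cumint u t) *: - u t).
  exact: is_derive1_comp.
split; first by case: isx.
by rewrite derive1E; case: isx => _ ->; rewrite scalerN [_ *: _]mulrC.
Qed.

(** After multiplication by exp (- U t), the exponents U t - U (g t) and
    U t - U (h t) in [step] become - U (g t) and - U (h t). *)
Lemma exp_sol_equation (t1 : R) (a b g h u : R -> R) (t : R) : t1 <= t ->
  u t = step t1 a b g h u t ->
  - (u t * exp_sol u t) + a t * exp_sol u (g t) - b t * exp_sol u (h t) = 0.
Proof.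
move=> t1t ->; rewrite /step t1t /exp_sol.
move: (cumint u t) (cumint u (g t)) (cumint u (h t)) (a t) (b t) => F G H p q.
rewrite mulrBl -!mulrA -!expRD [F - G]addrC [F - H]addrC !addrK.
by rewrite opprB subrK subrr.
Qed.

Lemma cumintB_restrict_le (a : R -> R) (t0 s t : R) :
  left_integrable (a \_ `[t0, +oo[) -> (forall r, t0 <= r -> 0 <= a r) ->
  t0 <= s -> s <= t ->
  cumint (a \_ `[t0, +oo[) t - cumint (a \_ `[t0, +oo[) s <=
  \int[leb]_(r in (`[s, t]%classic : set T)) a r.
Proof.
move=> iA a0 t0s st; rewrite cumintB//.
set A := a \_ _.
have A0 r : 0 <= A r.
  by rewrite /A patchE mem_setE in_itv/= andbT; case: ifPn => // /a0.
have -> : \int[leb]_(r in (`[s, t]%classic : set T)) a r =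
    \int[leb]_(r in (`[s, t]%classic : set T)) A r.
  apply: eq_Rintegral => r; rewrite inE/= in_itv/= => /andP[sr _].
  by rewrite /A patchE mem_setE in_itv/= andbT (le_trans t0s sr).
have m1 : measurable (`]s, t]%classic : set T) by exact: borel_lebesgue.
have m2 : measurable (`[s, t]%classic : set T) by exact: borel_lebesgue.
have s1 : `]s, t]%classic `<=` `]-oo, t]%classic.
  by move=> x /=; rewrite !in_itv/= => /andP[].
have s2 : `[s, t]%classic `<=` `]-oo, t]%classic.
  by move=> x /=; rewrite !in_itv/= => /andP[].
apply: fine_le.
- by apply: (integrable_fin_num m1); exact: left_integrable_itv s1.
- by apply: (integrable_fin_num m2); exact: left_integrable_itv s2.
- apply: (ge0_subset_integral _ m1 m2).
  + by apply/measurable_EFinP/measurable_funTS; exact: iA.1.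
  + by move=> x _; rewrite lee_fin.
  + exact: subset_itv_oc_cc.
Qed.

(** The lower bound on b is what makes the gain a * (expR al - 1) in the first
    term be compensated by the second one, whose factor expR (- q) is at least
    expR (- be). *)
Lemma expR_balance (a b p q al be : R) : 0 <= a -> 0 <= b ->
  p <= al -> q <= be -> a * (expR al - 1) * expR be <= b ->
  a * expR p - b * expR (- q) <= a.
Proof.
move=> a0 b0 pal qbe hb.
have h1 : a * expR p <= a * expR al by apply: ler_wpM2l => //; rewrite ler_expR.
have h2 : b * expR (- be) <= b * expR (- q).
  by apply: ler_wpM2l => //; rewrite ler_expR lerN2.
have h3 : a * (expR al - 1) <= b * expR (- be).
  have := ler_wpM2r (expR_ge0 (- be)) hb.
  by rewrite -[X in X <= _]mulrA -expRD subrr expR0 mulr1.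
by move: h3; rewrite mulrBr mulr1; lra.
Qed.

(** For t >= t1 the primitive of the extended function grows over ]g t, t] and
    ]t, h t] by at most the two integrals in the lower bound on b, so
    [expR_balance] applies; to the left of t1 the step vanishes. *)
Lemma step_restrict_le (t0 t1 : R) (a b g h : R -> R) :
  left_integrable (a \_ `[t0, +oo[) -> (forall t, t0 <= t -> 0 <= a t) ->
  (forall t, t0 <= t -> 0 <= b t) -> (forall t, t0 <= t -> g t <= t) -> (forall t, t0 <= t -> t <= h t) ->
  t0 <= t1 -> (forall t, t1 <= t -> t0 <= g t) ->
  (forall t, t1 <= t ->
    a t * (expR (\int[@leb R]_(s in `[g t, t]) a s) - 1)
        * expR (\int[@leb R]_(s in `[t, h t]) a s) <= b t) ->
  forall t, step t1 a b g h (a \_ `[t0, +oo[) t <= (a \_ `[t0, +oo[) t.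
Proof.
move=> iA a0 b0 gle hge t01 t0g blarge t.
have A0 r : 0 <= (a \_ `[t0, +oo[) r.
  by rewrite patchE mem_setE in_itv/= andbT; case: ifPn => // /a0.
rewrite /step; case: (boolP (t1 <= t)) => [t1t|_]; last exact: A0.
have t0t := le_trans t01 t1t.
rewrite [X in _ <= X]patchE mem_setE in_itv/= andbT t0t.
have := cumintB_restrict_le iA a0 (t0g _ t1t) (gle _ t0t).
have := cumintB_restrict_le iA a0 t0t (hge _ t0t).
rewrite -[X in b t * expR X]opprB => hle' gle'.
exact: expR_balance (a0 _ t0t) (b0 _ t0t) gle' hle' (blarge _ t1t).
Qed.

End exponential_of_primitive.

(** * Existence of an eventually positive nonincreasing solution *)

Theorem corollary1p2 (R : realType) (t0 : R) (a b g h : R -> R)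
  (a_meas : lebesgue_measurable_fun `[t0, +oo[ a)
  (b_meas : lebesgue_measurable_fun `[t0, +oo[ b)
  (g_meas : lebesgue_measurable_fun `[t0, +oo[ g)
  (h_meas : lebesgue_measurable_fun `[t0, +oo[ h)
  (a_bdd : locally_essentially_bounded t0 a)
  (b_bdd : locally_essentially_bounded t0 b)
  (g_bdd : locally_essentially_bounded t0 g)
  (h_bdd : locally_essentially_bounded t0 h)
  (a_ge0 : forall t, t0 <= t -> 0 <= a t)
  (b_ge0 : forall t, t0 <= t -> 0 <= b t)
  (g_le : forall t, t0 <= t -> g t <= t)
  (h_ge : forall t, t0 <= t -> t <= h t)
  (g_lim : g t @[t --> +oo] --> +oo)
  (ab : \forall t \near +oo, b t <= a t)
  (b_large : \forall t \near +oo,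
    a t * (expR (\int[@leb R]_(s in `[g t, t]) a s) - 1)
        * expR (\int[@leb R]_(s in `[t, h t]) a s) <= b t) :
  exists (t1 : R) (phi : R -> R) (x1 : R) (x : R -> R),
    [/\ t0 <= t1,
        is_solution a b g h t1 phi x1 x,
        \forall t \near +oo, 0 < x t
      & exists T : R, {ae @leb R, forall t : R, T <= t -> derive1 x t <= 0}].
Proof.
pose A := a \_ `[t0, +oo[.
have iA : left_integrable A := left_integrable_restrict a_meas a_bdd.
have A0 r : 0 <= A r.
  by rewrite /A patchE mem_setE in_itv/= andbT; case: ifPn => // /a_ge0.
(* From t1 on, the delayed argument g t stays in the domain of a, and both
   eventual hypotheses hold. *)
have [M [_ HM]] : \forall t \near +oo, [/\ t0 <= g t, b t <= a t &
    a t * (expR (\int[@leb R]_(s in `[g t, t]) a s) - 1)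
        * expR (\int[@leb R]_(s in `[t, h t]) a s) <= b t].
  have gt0 : \forall t \near +oo, t0 <= g t by move/cvgryPge : g_lim; exact.
  by apply: filterS3 gt0 ab b_large => t.
pose t1 := Num.max t0 (M + 1).
have t01 : t0 <= t1 by rewrite le_max lexx.
have Mt t : t1 <= t -> M < t.
  by rewrite ge_max => /andP[_]; apply: lt_le_trans; rewrite ltrDl.
have sub01 : `[t1, +oo[ `<=` `[t0, +oo[.
  by move=> t /=; rewrite !in_itv/= !andbT; exact: le_trans.
have m0 : measurable (`[t0, +oo[%classic : set (lebesgueTypeR R)).
  exact: borel_lebesgue.
have t0le t : t1 <= t -> t0 <= t by exact: le_trans.
have [u [iu bu uE]] : exists u : R -> R, [/\ left_integrable u,
    forall t, 0 <= u t <= A t & forall t, u t = step t1 a b g h u t].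
  apply: (step_fixpoint (A := A)).
  - by move=> t /t0le; exact: a_ge0.
  - by move=> t /t0le; exact: b_ge0.
  - by move=> t /t0le; exact: g_le.
  - by move=> t /t0le; exact: h_ge.
  - exact: measurable_funS m0 sub01 a_meas.
  - exact: measurable_funS m0 sub01 b_meas.
  - exact: measurable_funS m0 sub01 g_meas.
  - exact: measurable_funS m0 sub01 h_meas.
  - exact: iA.
  - exact: A0.
  - by move=> t /Mt /HM[].
  - apply: (step_restrict_le iA a_ge0 b_ge0 g_le h_ge t01).
      by move=> t /Mt /HM[].
    by move=> t /Mt /HM[].
have u0 t : 0 <= u t by have /andP[] := bu t.
have x' := exp_sol_derive iu.
exists t1, (exp_sol u), (exp_sol u t1), (exp_sol u); split.
- exact: t01.
- split=> [c t1c|||]; [| |by []|by []].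
  + have [K aK] := a_bdd c.
    apply: (exp_sol_ac (M := K)) => //.
    apply: filterS aK => t /= aK /andP[t1t tc].
    have t0t := t0le _ t1t.
    have /andP[_] := bu t; rewrite /A patchE mem_setE in_itv/= t0t/= => uA.
    by rewrite (le_trans uA)// (le_trans (ler_norm _))// aK// t0t.
  + apply: filterS x' => t [dx xE] t1t; split; first exact: dx.
    by rewrite xE; apply: exp_sol_equation t1t _.
- by apply: nearW => t; exact: expR_gt0.
- exists t1; apply: filterS x' => t [_ ->] _.
  by rewrite oppr_le0 mulr_ge0// expR_ge0.
Qed.
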